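(* Assume Assumption 1 (stated in the context) holds and $\lambda=\lambda_n>0$ with $\lambda\in o(1)$. Then \[\lim_{\substack{n,d\to\infty\\ d/n\to y}}\left\|\mathbb{E}\left(\hat\Sigma_n+\lambda I\right)^{-1}-\left(\Sigma_n+\lambda I\right)^{-1}\right\|\ \ge\ \frac{y\,\sigma_{\min}}{\sigma_{\max}^2}.\]
   Context: Asymptotic framework: a sequence of problems indexed by $n$, with dimension $d=d(n)$, $n,d\to\infty$ and $d/n\to y\in[0,1)$. For each $n$, $x\in\mathbb{R}^d$ is a random vector with $\mathbb{E}[x]=0$, $\mathrm{Cov}(x)=\Sigma_n$; $x_1,\dots,x_n$ i.i.d. copies of $x$ and $\hat\Sigma_n=\frac1n\sum_{i=1}^n x_ix_i^T$. Empirical spectral distribution $F_{\Sigma_n}(u)=d^{-1}\sum_{i=1}^d\mathbb{I}(\lambda_i\le u)$. $M=\sup_{\|e\|=1}\mathbb{E}(e^Tx)^4$, $\nu=\sup_{\|\Omega\|=1}\mathrm{Var}(x^T\Omega x/d)$. Assumption 1: (A1) $F_{\Sigma_n}(u)\to F_\Sigma(u)$ almost surely for almost every $u\ge0$; (A2) $M<\infty$, $\nu\to0$; (A3) eigenvalues of each $\Sigma_n$ lie in $[\sigma_{\min},\sigma_{\max}]$, $\sigma_{\min}>0$, $\sigma_{\max}$ independent of $n$. $\|\cdot\|$ is the spectral norm.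
   Formalization: The limit on the left need not exist under the stated assumptions (e.g. Rademacher coordinates with λ_n very small for even n and decaying slowly for odd n), so the bound is stated for the lower limit (liminf), which equals the limit whenever the limit exists. *)

(* Defs.v *)
From HB Require Import structures.
From mathcomp Require Import all_boot all_order all_algebra.
From mathcomp Require Import all_classical all_reals all_analysis.
Set Implicit Arguments. Unset Strict Implicit. Unset Printing Implicit Defensive.
Import Order.TTheory GRing.Theory Num.Theory.
Import numFieldNormedType.Exports.
Local Open Scope classical_set_scope.
Local Open Scope ring_scope.

Section defs.
Context (R : realType).

Definition vnorm {m : nat} (v : 'cV[R]_m) : R := Num.sqrt (\sum_i (v i 0) ^+ 2).

Definition opnorm {m : nat} (A : 'M[R]_m) : R :=
  sup [set r | exists v : 'cV[R]_m, vnorm v = 1 /\ r = vnorm (A *m v)].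

Context (d0 : measure_display) (T : measurableType d0) (P : probability T R).

Definition rvec_measurable {m : nat} (x : T -> 'cV[R]_m) : Prop :=
  forall j : 'I_m, measurable_fun setT (fun w => x w j 0).

Definition box_event {m : nat} (x : T -> 'cV[R]_m) (B : 'I_m -> set R) : set T :=
  [set w | forall j, B j (x w j 0)].

(* equality in law of random vectors (laws agree on measurable boxes, which
   form a pi-system generating the Borel sets of R^m) *)
Definition same_law {m : nat} (x x' : T -> 'cV[R]_m) : Prop :=
  forall B : 'I_m -> set R, (forall j, measurable (B j)) ->
    P (box_event x B) = P (box_event x' B).

Definition indep_family {n m : nat} (X : 'I_n -> T -> 'cV[R]_m) : Prop :=
  forall B : 'I_n -> 'I_m -> set R, (forall i j, measurable (B i j)) ->
    P (\bigcap_(i in [set: 'I_n]) box_event (X i) (B i)) =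
    (\prod_(i < n) P (box_event (X i) (B i)))%E.

Definition cov_mx {m : nat} (x : T -> 'cV[R]_m) : 'M[R]_m :=
  \matrix_(j, k) fine (covariance P (fun w => x w j 0) (fun w => x w k 0)).

Definition E_mx {m : nat} (A : T -> 'M[R]_m) : 'M[R]_m :=
  \matrix_(j, k) fine ('E_P[fun w => A w j k])%E.

Definition Shat {n m : nat} (X : 'I_n -> T -> 'cV[R]_m) (w : T) : 'M[R]_m :=
  n%:R^-1 *: \sum_(i < n) (X i w *m (X i w)^T).

Definition moment4 {m : nat} (x : T -> 'cV[R]_m) : \bar R :=
  ereal_sup [set ('E_P[fun w => (((e^T *m x w) 0 0) ^+ 4)%R])%E
            | e in [set e : 'cV[R]_m | vnorm e = 1]].

Definition nu {m : nat} (x : T -> 'cV[R]_m) : \bar R :=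
  ereal_sup [set 'V_P[fun w => (((x w)^T *m Om *m x w) 0 0 / m%:R)%R]
            | Om in [set Om : 'M[R]_m | opnorm Om = 1]].

End defs.

(* empirical spectral distribution of a d x d matrix whose eigenvalues, with
   multiplicity, are the list s: F(u) = d^-1 #{i | lambda_i <= u} *)
Definition esd {R : realType} (s : seq R) (m : nat) (u : R) : R :=
  (count (fun a => a <= u) s)%:R / m%:R.

(* Main.v *)
Require Import Defs.
From HB Require Import structures.
From mathcomp Require Import all_boot all_order all_algebra.
From mathcomp Require Import all_classical all_reals all_analysis.
From mathcomp Require Import ring lra measurable_realfun.
Import Order.TTheory GRing.Theory Num.Theory.
Import numFieldNormedType.Exports.
Local Open Scope classical_set_scope.
Local Open Scope ring_scope.

(** Write [S] for the sample covariance and [Sigma] for the covariance matrix,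
    and fix a regularization [mu > 0] not depending on [n].  Expanding
    [tr ((S + mu)^-1 (S + mu)) = d] gives
      [d - mu tr (S + mu)^-1 = sum_i q_i / (1 + q_i)],
    where [q_i = x_i^T H_i x_i / n] and [H_i] is the resolvent without [x_i].
    By independence [E q_i = tr (E[H_i] Sigma) / n], so concavity of
    [q / (1 + q)] yields [d (1 - O(mu)) <= n tau / (1 + tau)] for any [tau]
    bounding these means.  Removing one sample changes the trace by at most
    [smax / mu], and [(S + mu)^-1 <= (S + lambda)^-1], so if the operator norm
    in the theorem is at most [c] one may take
    [tau = (d / n) (1 + c smax) + o(1)].  Letting [n] grow and then [mu] tend
    to [0] gives [y (1 + tau) <= tau], hence [c smax >= y].  The fixed [mu] is
    what makes this work for [lambda_n] tending to [0] arbitrarily fast. *)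

Set Implicit Arguments. Unset Strict Implicit. Unset Printing Implicit Defensive.

(** * Symmetric matrices bounded below *)

Section dot_product.
Context {R : realType} {m : nat}.
Implicit Types (u v w x : 'cV[R]_m) (M N : 'M[R]_m) (a c : R).

Definition dot u v : R := (u^T *m v) 0 0.

Lemma dotE u v : dot u v = \sum_i u i 0 * v i 0.
Proof. by rewrite /dot mxE; apply: eq_bigr => i _; rewrite mxE. Qed.

Lemma dotC u v : dot u v = dot v u.
Proof. by rewrite !dotE; apply: eq_bigr => i _; rewrite mulrC. Qed.

Lemma dotDr u v w : dot u (v + w) = dot u v + dot u w.
Proof. by rewrite /dot mulmxDr mxE. Qed.

Lemma dotZr a u v : dot u (a *: v) = a * dot u v.
Proof. by rewrite /dot -scalemxAr mxE. Qed.

Lemma dotDl u v w : dot (v + w) u = dot v u + dot w u.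
Proof. by rewrite dotC dotDr !(dotC u). Qed.

Lemma dotZl a u v : dot (a *: u) v = a * dot u v.
Proof. by rewrite dotC dotZr dotC. Qed.

Lemma dotNr u v : dot u (- v) = - dot u v.
Proof. by rewrite -scaleN1r dotZr mulN1r. Qed.

Lemma dotNl u v : dot (- u) v = - dot u v.
Proof. by rewrite dotC dotNr dotC. Qed.

Definition dotl := (dotDl, dotDr, dotZl, dotZr, dotNl, dotNr).

Lemma dot_ge0 u : 0 <= dot u u.
Proof. by rewrite dotE sumr_ge0// => i _; rewrite -expr2 sqr_ge0. Qed.

Lemma dot_eq0 u : dot u u = 0 -> u = 0.
Proof.
rewrite dotE => /psumr_eq0P u0; apply/colP => i; rewrite mxE.
have /eqP := u0 (fun i _ => ltac:(by rewrite -expr2 sqr_ge0)) i isT.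
by rewrite mulf_eq0 orbb => /eqP.
Qed.

Lemma sqr_coord_le u i : u i 0 ^+ 2 <= dot u u.
Proof.
rewrite dotE (bigD1 i)//= expr2 lerDl sumr_ge0// => j _.
by rewrite -expr2 sqr_ge0.
Qed.

Lemma dot_trmx M u v : dot u (M *m v) = dot (M^T *m u) v.
Proof. by rewrite /dot trmx_mul trmxK mulmxA. Qed.

Lemma mul_outer x v : x *m x^T *m v = dot x v *: x.
Proof.
apply/colP => i; rewrite -mulmxA !mxE big_ord1 mulrC; congr (_ * _).
Qed.

Lemma dot_delta M i : dot (delta_mx i 0) (M *m delta_mx i 0) = M i i.
Proof. by rewrite /dot -colE trmx_delta -rowE !mxE. Qed.

Lemma quad_sum M v : dot v (M *m v) = \sum_i \sum_j M i j * (v i 0 * v j 0).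
Proof.
rewrite dotE; apply: eq_bigr => i _; rewrite mxE mulr_sumr.
by apply: eq_bigr => j _; rewrite mulrCA.
Qed.

(** A crude constant is enough: the bound only serves to show that suprema are finite and that an
    inverse has a bounded quadratic form. *)
Lemma quad_le_sum_norm M v :
  dot v (M *m v) <= (\sum_i \sum_j `|M i j|) * dot v v.
Proof.
rewrite quad_sum mulr_suml ler_sum// => i _; rewrite mulr_suml ler_sum// => j _.
have h : `|v i 0 * v j 0| <= dot v v.
  have := sqr_coord_le v i; have := sqr_coord_le v j.
  by rewrite ler_norml => *; apply/andP; split; nra.
by rewrite (le_trans (ler_norm _))// normrM ler_wpM2l.
Qed.

(** This is the order relation [c I <= M] between symmetric matrices. An upper bound [M <= c I] is
    expressed as [coercive (- c) (- M)]. *)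
Definition coercive c M := M^T = M /\ forall v, c * dot v v <= dot v (M *m v).

Lemma coercive_unit c M : 0 < c -> coercive c M -> M \in unitmx.
Proof.
move=> c0 [MT Mc]; rewrite -row_free_unit; apply/inj_row_free => v vM.
have : M *m v^T = 0 by rewrite -MT -trmx_mul vM trmx0.
have := Mc v^T => /[swap] ->; rewrite {2}/dot mulmx0 mxE => h.
have : dot v^T v^T = 0 by apply: le_anti; rewrite dot_ge0 andbT; nra.
by move/dot_eq0/(congr1 trmx); rewrite trmxK trmx0.
Qed.

Lemma coercive_ge0 c M v : 0 <= c -> coercive c M -> 0 <= dot v (M *m v).
Proof. by move=> c0 [_ /(_ v)]; apply: le_trans; rewrite mulr_ge0 ?dot_ge0. Qed.

Lemma coerciveDscalar c a M : coercive c M -> coercive (c + a) (M + a%:M).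
Proof.
move=> [MT Mc]; split; first by rewrite linearD/= MT tr_scalar_mx.
by move=> v; rewrite mulmxDl mul_scalar_mx dotDr dotZr mulrDl lerD2r.
Qed.

Lemma dot_invmx_ge c M v : 0 < c -> coercive c M ->
  c * dot (invmx M *m v) (invmx M *m v) <= dot v (invmx M *m v).
Proof.
move=> c0 cM; have := cM.2 (invmx M *m v).
by rewrite mulKVmx ?(coercive_unit c0 cM)// (dotC _ v).
Qed.

Lemma dot_invmx_ge0 c M v : 0 < c -> coercive c M -> 0 <= dot v (invmx M *m v).
Proof.
move=> c0 cM; apply: le_trans (dot_invmx_ge v c0 cM).
by rewrite mulr_ge0 ?dot_ge0// ltW.
Qed.

Lemma dot_invmx_le c M v : 0 < c -> coercive c M ->
  dot v (invmx M *m v) <= c^-1 * dot v v.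
Proof.
move=> c0 cM; rewrite ler_pdivlMl//.
have := dot_invmx_ge v c0 cM; set w := invmx M *m v => h.
(* Expanding [|c w - v|^2 >= 0] and inserting [c |w|^2 <= v . w] leaves [c (v . w) <= |v|^2]. *)
have := dot_ge0 (c *: w - v); rewrite !dotl (dotC w v) => h'.
nra.
Qed.

(** The column [w = M^-1 e_j] satisfies [c |w|^2 <= e_j . w <= c^-1]. This deterministic bound makes
    all resolvent entries integrable. *)
Lemma invmx_coord_le c M i j : 0 < c -> coercive c M ->
  `|invmx M i j| <= c^-1.
Proof.
move=> c0 cM; pose e : 'cV[R]_m := delta_mx j 0.
have ee : dot e e = 1.
  by have := dot_delta 1%:M j; rewrite mul1mx => ->; rewrite mxE eqxx.
have h1 := dot_invmx_ge e c0 cM; have h2 := dot_invmx_le e c0 cM.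
have h3 := sqr_coord_le (invmx M *m e) i.
rewrite ee mulr1 in h2.
have ci : 0 < c^-1 by rewrite invr_gt0.
have : (invmx M *m e) i 0 ^+ 2 <= c^-1 ^+ 2.
  rewrite (le_trans h3)// expr2 ler_pdivlMl//; exact: le_trans h2.
rewrite -colE mxE => h.
by rewrite ler_norml; apply/andP; split; nra.
Qed.

Lemma trmx_invmx M : M^T = M -> (invmx M)^T = invmx M.
Proof. by move=> MT; rewrite trmx_inv MT. Qed.

(** With [u = M^-1 v] and [w = (M + a)^-1 v] one has [M (u - w) = a w]. Positivity of [M] at [u - w]
    gives [a (u . w) >= a |w|^2], and [v . u - v . w = a (u . w)]. *)
Lemma dot_invmx_anti c a M v : 0 < c -> 0 <= a -> coercive c M ->
  dot v (invmx (M + a%:M) *m v) <= dot v (invmx M *m v).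
Proof.
move=> c0 a0 cM; have cMa := coerciveDscalar a cM.
have Mu := coercive_unit c0 cM.
have Mau : M + a%:M \in unitmx.
  by apply: coercive_unit cMa; rewrite ltr_wpDr.
set w := invmx (M + a%:M) *m v; set u := invmx M *m v.
have Mu_v : M *m u = v by rewrite mulKVmx.
have Mw : M *m w = v - a *: w.
  have : (M + a%:M) *m w = v by rewrite mulKVmx.
  by rewrite mulmxDl mul_scalar_mx => <-; rewrite addrK.
have h := coercive_ge0 (u - w) (ltW c0) cM.
rewrite mulmxBr Mu_v Mw opprB addrCA subrr addr0 !dotl in h.
have e1 : dot u (M *m w) = dot v w by rewrite dot_trmx cM.1 Mu_v.
rewrite Mw !dotl (dotC u v) in e1.
have := dot_ge0 w; nra.
Qed.

Section rank_one_update.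
Variables (c a : R) (M : 'M[R]_m) (x : 'cV[R]_m).
Hypotheses (c0 : 0 < c) (a0 : 0 <= a) (cM : coercive c M).
Let N := M + a *: (x *m x^T).
Let q := a * dot x (invmx M *m x).

Lemma coercive_rank_one : coercive c N.
Proof.
split; first by rewrite /N linearD linearZ/= trmx_mul trmxK cM.1.
move=> v; rewrite /N mulmxDl -scalemxAl mul_outer !dotl (dotC v x).
have := cM.2 v; have := mulr_ge0 a0 (sqr_ge0 (dot x v)).
by rewrite expr2; lra.
Qed.

Lemma rank_one_ge0 : 0 <= q.
Proof. by rewrite /q mulr_ge0// (dot_invmx_ge0 _ c0 cM). Qed.

(** Sherman-Morrison applied to [x]: the updated matrix [N] sends [M^-1 x] to [(1 + q) x]. *)
Lemma invmx_rank_one_mul : invmx N *m x = (1 + q)^-1 *: (invmx M *m x).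
Proof.
have q0 := rank_one_ge0; have q1 : 1 + q != 0 by rewrite gt_eqF// ltr_pwDl.
have Nu := coercive_unit c0 coercive_rank_one.
have Mu := coercive_unit c0 cM.
have h : N *m (invmx M *m x) = (1 + q) *: x.
  by rewrite /N mulmxDl -scalemxAl mul_outer mulKVmx// scalerDl scale1r scalerA.
by rewrite -[LHS](scalerK q1) scalemxAr -h mulKmx.
Qed.

Lemma dot_rank_one : a * dot x (invmx N *m x) = 1 - (1 + q)^-1.
Proof.
rewrite invmx_rank_one_mul dotZr mulrCA -/q.
have := rank_one_ge0 => q0; field; lra.
Qed.

(** The resolvent identity [M^-1 = N^-1 + N^-1 (N - M) M^-1] with [N - M] of rank one. It is solved
    for [M^-1] because leaving a sample out passes from [N] to [M]. *)
Lemma invmx_rank_one : invmx M =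
  invmx N + (a / (1 + q)) *: (invmx M *m x *m (invmx M *m x)^T).
Proof.
have Nu := coercive_unit c0 coercive_rank_one.
have Mu := coercive_unit c0 cM.
have {1}-> : invmx M = invmx N + invmx N *m (N - M) *m invmx M.
  by rewrite mulmxBr mulVmx// mulmxBl mul1mx -mulmxA mulmxV// mulmx1 addrC subrK.
congr (_ + _).
rewrite /N addrAC subrr add0r -scalemxAr -scalemxAl !mulmxA.
rewrite invmx_rank_one_mul -!scalemxAl scalerA trmx_mul (trmx_invmx cM.1).
by rewrite !mulmxA.
Qed.
End rank_one_update.

(* The largest [c] with [coercive c M] is attained; were it below every
   eigenvalue, [M - c] would be invertible and [c] could be increased. *)
Lemma coercive_char_poly M s : M^T = M ->
  (forall a, root (char_poly M) a -> s <= a) -> coercive s M.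
Proof.
move=> MT rootM; split=> // v0; rewrite leNgt; apply/negP => v0lt.
pose E := [set c | coercive c M].
have coer_le b c : b <= c -> coercive c M -> coercive b M.
  move=> bc [_ Mc]; split=> // v; apply: le_trans (Mc v).
  by rewrite ler_wpM2r ?dot_ge0.
have Eub : ubound E s.
  move=> c Ec; rewrite leNgt; apply/negP => sc.
  by have := (coer_le _ _ (ltW sc) Ec).2 v0; rewrite leNgt v0lt.
have E0 : E !=set0.
  exists (- \sum_i \sum_j `|(- M) i j|); split=> // v.
  by rewrite mulNr lerNl -dotNr -mulNmx quad_le_sum_norm.
have supE : has_sup E by split=> //; exists s.
have coer_sup : coercive (sup E) M.
  split=> // v; have [v_0|v_neq0] := eqVneq (dot v v) 0.
    by rewrite (dot_eq0 v_0) mulmx0 /dot !mulmx0 !mxE mulr0.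
  have vv : 0 < dot v v by rewrite lt_neqAle eq_sym v_neq0 dot_ge0.
  rewrite -ler_pdivlMr//; apply: ge_sup => // c [_ /(_ v)].
  by rewrite ler_pdivlMr.
have sup_lt : sup E < s.
  rewrite lt_neqAle ge_sup// andbT; apply/eqP => sE.
  by have := coer_sup.2 v0; rewrite sE leNgt v0lt.
pose N := M + (- sup E)%:M.
have coerN : coercive 0 N.
  by have := coerciveDscalar (- sup E) coer_sup; rewrite subrr.
have Nu : N \in unitmx.
  rewrite unitmxE unitfE; apply/negP => /eqP detN.
  have : root (char_poly M) (sup E).
    rewrite -eigenvalue_root_char /eigenvalue /eigenspace kermx_eq0.
    by rewrite row_free_unit unitmxE unitfE -raddfN -/N detN eqxx.
  by move/rootM; rewrite leNgt sup_lt.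
(* [K] bounds the quadratic form of [N^-1]; the added 1 keeps it positive, so that [sup E] can be
   raised by [K^-1]. *)
set K := 1 + \sum_i \sum_j `|invmx N i j|.
have K1 : 1 <= K.
  by rewrite lerDl sumr_ge0// => i _; rewrite sumr_ge0.
have K0 : 0 < K by rewrite (lt_le_trans ltr01).
have : E (sup E + K^-1).
  split=> // v; set u := invmx N *m v.
  have Nuv : N *m u = v by rewrite mulKVmx.
  have uv : dot u v <= K * dot v v.
    rewrite dotC (le_trans (quad_le_sum_norm _ _))// ler_wpM2r ?dot_ge0//.
    by rewrite lerDr.
  (* Positivity of [N] at [v - K^-1 u], where [N u = v], reads [v . N v - 2 K^-1 |v|^2 + K^-2 (u .
     v) >= 0]. Since [u . v <= K |v|^2], this gives [v . N v >= K^-1 |v|^2]. *)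
  have := coerN.2 (v - K^-1 *: u).
  rewrite mul0r mulmxBr -scalemxAr Nuv !dotl.
  have -> : dot u (N *m v) = dot v v by rewrite dot_trmx coerN.1 Nuv.
  have -> : dot v (N *m v) = dot v (M *m v) - sup E * dot v v.
    by rewrite mulmxDl mul_scalar_mx dotDr dotZr mulNr.
  have : K^-1 * (K^-1 * dot u v) <= K^-1 * dot v v.
    rewrite ler_wpM2l ?invr_ge0 ?(ltW K0)//.
    by rewrite ler_pdivrMl.
  rewrite mulrDl; lra.
move=> /(ub_le_sup (ex_intro _ _ Eub)).
by rewrite leNgt ltrDl invr_gt0 K0.
Qed.
End dot_product.

(** * The operator norm and measurability of inverses *)

Section operator_norm.
Context {R : realType} {m : nat}.
Implicit Types (v : 'cV[R]_m) (M : 'M[R]_m).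

Lemma vnormE v : vnorm v = Num.sqrt (dot v v).
Proof. by rewrite /vnorm dotE. Qed.

Lemma vnorm_ge0 v : 0 <= vnorm v.
Proof. by rewrite vnormE sqrtr_ge0. Qed.

Lemma vnorm_sqr v : vnorm v ^+ 2 = dot v v.
Proof. by rewrite vnormE sqr_sqrtr// dot_ge0. Qed.

Lemma vnorm_mul_le_opnorm M v : vnorm v = 1 -> vnorm (M *m v) <= opnorm M.
Proof.
move=> v1; apply: ub_le_sup; last by exists v.
(* On unit vectors [|M u|^2 = u . M^T M u <= K <= (1 + K)^2]. Boundedness has to be shown because
   [sup] is only meaningful on bounded sets. *)
set K := \sum_i \sum_j `|(M^T *m M) i j|.
exists (1 + K) => _ [u [u1 ->]].
have K0 : 0 <= K by rewrite sumr_ge0// => i _; rewrite sumr_ge0.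
rewrite -(@ler_pXn2r _ 2)// ?nnegrE ?vnorm_ge0 ?addr_ge0//.
rewrite vnorm_sqr dot_trmx mulmxA dotC.
rewrite (le_trans (quad_le_sum_norm _ _))// -vnorm_sqr u1 expr1n mulr1 -/K.
nra.
Qed.

Lemma opnorm_ge0 M : 0 <= opnorm M.
Proof.
have [[r [v [v1 _]]]|/nonemptyPn E0] := pselect ([set r | exists v : 'cV[R]_m,
    vnorm v = 1 /\ r = vnorm (M *m v)] !=set0).
  exact: le_trans (vnorm_ge0 _) (vnorm_mul_le_opnorm M v1).
(* Without unit vectors, as in dimension zero, the supremum takes its default value 0. *)
by rewrite /opnorm E0 sup0.
Qed.

Lemma dot_le_vnorm u v : dot u v <= vnorm u * vnorm v.
Proof.
have [u0|u0] := eqVneq (dot u u) 0.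
  by rewrite (dot_eq0 u0) dotC /dot mulmx0 mxE mulr_ge0 ?vnorm_ge0.
have [v0|v0] := eqVneq (dot v v) 0.
  by rewrite (dot_eq0 v0) /dot mulmx0 mxE mulr_ge0 ?vnorm_ge0.
have up : 0 < vnorm u by rewrite vnormE sqrtr_gt0 lt_neqAle eq_sym u0 dot_ge0.
have vp : 0 < vnorm v by rewrite vnormE sqrtr_gt0 lt_neqAle eq_sym v0 dot_ge0.
have := dot_ge0 (vnorm v *: u - vnorm u *: v).
rewrite !dotl -!vnorm_sqr (dotC v u) => h.
have : 0 < vnorm u * vnorm v by rewrite mulr_gt0.
nra.
Qed.

(** Cauchy-Schwarz, after rescaling [v] to a unit vector. *)
Lemma quad_le_opnorm M v : dot v (M *m v) <= opnorm M * dot v v.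
Proof.
have [v0|v0] := eqVneq (dot v v) 0.
  by rewrite v0 (dot_eq0 v0) /dot !mulmx0 mxE mulr0.
have vp : 0 < vnorm v by rewrite vnormE sqrtr_gt0 lt_neqAle eq_sym v0 dot_ge0.
rewrite -vnorm_sqr expr2 mulrA mulrC.
apply: le_trans (dot_le_vnorm _ _) _; rewrite ler_pM2l//.
have Ev : v = vnorm v *: ((vnorm v)^-1 *: v) by rewrite scalerA divff ?gt_eqF ?scale1r.
have n1 : vnorm ((vnorm v)^-1 *: v) = 1.
  rewrite [LHS]vnormE !dotl -vnorm_sqr -[RHS]sqrtr1; congr Num.sqrt.
  by field; rewrite gt_eqF.
have := vnorm_mul_le_opnorm M n1.
rewrite -scalemxAr vnormE !dotl mulrA -expr2 sqrtrM ?sqr_ge0// sqrtr_sqr.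
by rewrite gtr0_norm ?invr_gt0// -vnormE ler_pdivrMl// mulrC.
Qed.

Lemma trace_ge0 M : (forall v, 0 <= dot v (M *m v)) -> 0 <= \tr M.
Proof. by move=> M0; rewrite sumr_ge0// => i _; rewrite -dot_delta. Qed.

End operator_norm.

Section measurability.
Context {R : realType} {d : measure_display} {T : measurableType d}.

(* [x^-1 = x * (x ^ 2)^-1] reduces to inverses of nonnegative reals, i.e. to
   [powR]. *)
Lemma measurable_inv : measurable_fun [set: R] (@GRing.inv R).
Proof.
rewrite (_ : GRing.inv = (fun x => x * (x ^+ 2) `^ (-1))); last first.
  apply/funext => x; have [->|x0] := eqVneq x 0; first by rewrite invr0 mul0r.
  by rewrite powR_inv1 ?sqr_ge0// expr2 invfM mulrA divff// mul1r.
apply: measurable_funM => //.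
by apply: (measurableT_comp (measurable_powR (-1))).
Qed.

Lemma measurable_det m (A : T -> 'M[R]_m) :
  (forall i j, measurable_fun setT (fun w => A w i j)) ->
  measurable_fun setT (fun w => \det (A w)).
Proof.
move=> mA; apply: measurable_sum => s; apply: measurable_funM => //.
by apply: measurable_prod => i _.
Qed.

Lemma measurable_invmx m (A : T -> 'M[R]_m) :
  (forall w, A w \in unitmx) ->
  (forall i j, measurable_fun setT (fun w => A w i j)) ->
  forall i j, measurable_fun setT (fun w => invmx (A w) i j).
Proof.
move=> uA mA i j.
rewrite (_ : (fun w => _) =
    (fun w => (\det (A w))^-1 * cofactor (A w) j i)); last first.
  by apply/funext => w; rewrite /invmx uA !mxE.
apply: measurable_funM.
  exact: (measurableT_comp measurable_inv (measurable_det mA)).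
apply: measurable_funM => //; apply: measurable_det => k l.
by under eq_fun do rewrite !mxE; exact: mA.
Qed.

End measurability.

(** * Independence *)

Section independence.
Context {R : realType}.

Lemma eq_measure_rectangle d1 d2 (T1 : measurableType d1) (T2 : measurableType d2)
    (m1 m2 : {measure set (T1 * T2) -> \bar R}) :
  (m1 setT < +oo)%E ->
  (forall A B, measurable A -> measurable B -> m1 (A `*` B) = m2 (A `*` B)) ->
  forall X, measurable X -> m1 X = m2 X.
Proof.
move=> m1oo m12 X mX.
pose C : set (set (T1 * T2)) :=
  [set C | exists A, measurable A /\ exists B, measurable B /\ C = A `*` B].
apply: (measure_unique C (fun _ => setT)) => //.
- rewrite measurable_prod_measurableType; congr (<<s _ >>).
  rewrite predeqE; split => [[A mA [B mB <-]]|[A [mA [B [mB ->]]]]].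
    by exists A; split => //; exists B.
  by exists A => //; exists B.
- move=> _ _ [X1 [mX1 [X2 [mX2 ->]]]] [Y1 [mY1 [Y2 [mY2 ->]]]].
  rewrite -setXI; exists (X1 `&` Y1); split; first exact: measurableI.
  by exists (X2 `&` Y2); split => //; exact: measurableI.
- move=> _; exists setT; split => //; exists setT; split => //.
  by rewrite setXTT.
- by rewrite bigcup_const.
- by move=> _ [A [mA [B [mB ->]]]]; exact: m12.
Qed.

Context {d : measure_display} {T : measurableType d} (P : probability T R).

Section product_law.
Context {d1 d2 : measure_display} {T1 : measurableType d1} {T2 : measurableType d2}.
Variables (C : set T) (u v : {mfun T >-> (T1 * T2)%type}).
Hypothesis mC : measurable C.
Hypothesis uv : forall A B, measurable A -> measurable B ->
  P (C `&` u @^-1` (A `*` B)) = (P C * P (v @^-1` (A `*` B)))%E.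

(** In [X], the left side is the image under [u] of [P] restricted to [C], and the right side is a
    multiple of the law of [v]. Finite measures that agree on rectangles are equal. *)
Lemma product_law_rectangle X : measurable X ->
  P (C `&` u @^-1` X) = (P C * P (v @^-1` X))%E.
Proof.
move=> mX.
have mu : measurable_fun setT u by [].
have mv : measurable_fun setT v by [].
pose m1 := measure_function_pushforward__canonical__measure_function_Measure
  (measure_function_mrestr__canonical__measure_function_Measure P mC) mu.
have PC0 : 0 <= fine (P C) by rewrite fine_ge0.
pose m2 := measure_function_mscale__canonical__measure_function_Measure
  (NngNum PC0)
  (measure_function_pushforward__canonical__measure_function_Measure P mv).
have PCfin : P C \is a fin_num by rewrite fin_num_measure.
have m2E Y : m2 Y = (P C * P (v @^-1` Y))%E.
  by rewrite /m2 /= /mscale /= fineK.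
have m1E Y : m1 Y = P (C `&` u @^-1` Y) by rewrite setIC.
rewrite -m1E -m2E; apply: eq_measure_rectangle => //.
  by rewrite m1E preimage_setT setIT ltey_eq PCfin.
by move=> A B mA mB; rewrite m1E m2E uv.
Qed.
End product_law.

(** The hypothesis on preimages says that [h] is independent of [(f, g)] and that [(f, g)] has the
    law of [(f', g')]. Hence [(h, (f, g))] has a product law: Tonelli yields integrability, then
    Fubini factors the integral. *)
Lemma integral_indep_mul (h f g : T -> R) (f' g' : T -> R) :
  measurable_fun setT h -> measurable_fun setT f -> measurable_fun setT g ->
  measurable_fun setT f' -> measurable_fun setT g' ->
  (forall A B C, measurable A -> measurable B -> measurable C ->
    P (h @^-1` C `&` (f @^-1` A `&` g @^-1` B)) =
    (P (h @^-1` C) * P (f' @^-1` A `&` g' @^-1` B))%E) ->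
  P.-integrable setT (EFin \o h) ->
  P.-integrable setT (EFin \o (f' \* g')) ->
  P.-integrable setT (EFin \o (h \* (f \* g))) /\
  \int[P]_w (h w * (f w * g w)) = \int[P]_w h w * \int[P]_w (f' w * g' w).
Proof.
move=> mh mf mg mf' mg' hfg ih ifg'.
pose H : {mfun T >-> R} := MeasurableFun.Pack
  (MeasurableFun.Class (isMeasurableFun.Build _ _ _ _ _ mh)).
have mu := measurable_fun_pair mf mg.
pose U : {mfun T >-> (R * R)%type} := MeasurableFun.Pack
  (MeasurableFun.Class (isMeasurableFun.Build _ _ _ _ _ mu)).
have mv := measurable_fun_pair mf' mg'.
pose V : {mfun T >-> (R * R)%type} := MeasurableFun.Pack
  (MeasurableFun.Class (isMeasurableFun.Build _ _ _ _ _ mv)).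
have mw := measurable_fun_pair mh mu.
pose W : {mfun T >-> (R * (R * R))%type} := MeasurableFun.Pack
  (MeasurableFun.Class (isMeasurableFun.Build _ _ _ _ _ mw)).
pose m1 := distribution P H. pose m2 := distribution P V.
have law X : measurable X -> (m1 \x m2)%E X = distribution P W X.
  apply: product_measure_unique => A B mA mB.
  have mHA : measurable (H @^-1` A) by have := mh measurableT _ mA; rewrite setTI.
  rewrite -(product_law_rectangle (u := U) mHA)// => A' B' mA' mB'.
  exact: hfg.
pose phi : R * (R * R) -> \bar R := fun z => (z.1 * (z.2.1 * z.2.2))%:E.
have mphi : measurable_fun setT phi.
  apply/measurable_EFinP; apply: measurable_funM => //.
  by apply: measurable_funM; apply: measurableT_comp.
have abs_prod : (\int[m1 \x m2]_z `|phi z| < +oo)%E.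
  rewrite fubini_tonelli1//; last exact: measurableT_comp.
  have -> : (\int[m1]_x fubini_F m2 (fun z => `|phi z|) x =
      \int[m1]_x (`|x|%:E * \int[m2]_y `|y.1 * y.2|%:E))%E.
    apply: eq_integral => x _; rewrite /fubini_F -ge0_integralZl//.
      by apply: eq_integral => y _; rewrite /phi /= normrM EFinM.
    apply/measurable_EFinP; apply: measurableT_comp => //.
    by apply: measurable_funM.
  have h1 : (\int[m1]_x `|x|%:E < +oo)%E.
    rewrite ge0_integral_distribution//; last exact/measurable_EFinP.
    by case/integrableP : ih.
  have h2 : (\int[m2]_y `|y.1 * y.2|%:E < +oo)%E.
    rewrite ge0_integral_distribution//.
      by case/integrableP : ifg'.
    apply/measurable_EFinP; apply: measurableT_comp => //.
    by apply: measurable_funM.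
  rewrite ge0_integralZr//; last 2 first.
  - exact/measurable_EFinP.
  - by apply: integral_ge0 => y _; rewrite lee_fin.
  by rewrite lte_mul_pinfty// ?integral_ge0// ge0_fin_numE// integral_ge0.
have iprod : (m1 \x m2)%E.-integrable setT phi by apply/integrableP.
have iW : P.-integrable setT (phi \o W).
  apply/integrableP; split; first exact: measurableT_comp.
  have := abs_prod; rewrite (eq_measure_integral (distribution P W)); last first.
    by move=> X mX _; exact: law.
  by rewrite ge0_integral_distribution//; exact: measurableT_comp.
split => //.
have -> : \int[P]_w (h w * (f w * g w)) = fine (\int[m1 \x m2]_z phi z)%E.
  rewrite (eq_measure_integral (distribution P W)); last first.
    by move=> X mX _; exact: law.
  by rewrite integral_distribution.
have i2 : m2.-integrable setT (fun y => (y.1 * y.2)%:E).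
  apply/integrableP; split.
    by apply/measurable_EFinP; exact: measurable_funM.
  rewrite ge0_integral_distribution//.
    by case/integrableP : ifg'.
  apply: measurableT_comp => //.
  by apply/measurable_EFinP; exact: measurable_funM.
have i1 : m1.-integrable setT (fun x => x%:E).
  apply/integrableP; split; first exact/measurable_EFinP.
  rewrite ge0_integral_distribution//; first by case/integrableP : ih.
  exact/measurable_EFinP.
rewrite -integral12_prod_meas1//.
have -> : (\int[m1]_x fubini_F m2 phi x =
      \int[m1]_x (x%:E * \int[m2]_y (y.1 * y.2)%:E))%E.
  apply: eq_integral => x _; rewrite /fubini_F -integralZl//.
have E2 : (\int[m2]_y (y.1 * y.2)%:E)%E = (\int[P]_w (f' w * g' w)%:E)%E.
  rewrite integral_distribution//.
  by apply/measurable_EFinP; exact: measurable_funM.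
have E1 : (\int[m1]_x x%:E)%E = (\int[P]_w (h w)%:E)%E.
  by rewrite integral_distribution//; exact/measurable_EFinP.
have fin2 : (\int[P]_w (f' w * g' w)%:E)%E \is a fin_num.
  exact: integrable_fin_num ifg'.
rewrite E2 -(fineK fin2) integralZr// E1 fineM//.
exact: integrable_fin_num ih.
Qed.
End independence.

(** * Independence of one sample from all the others *)

Section sample.
Context {R : realType} {d : measure_display} {T : measurableType d} (P : probability T R).
Context {n m : nat} (X : 'I_n -> T -> 'cV[R]_m).
Hypothesis mX : forall i, rvec_measurable (X i).
Hypothesis indepX : indep_family P X.

(** A pi-system generating the sigma-algebra of all samples except the [i]-th. It consists of boxes
    because [indep_family] speaks of boxes. *)
Definition other_events (i : 'I_n) : set (set T) :=
  [set A | exists B : 'I_n -> 'I_m -> set R, (forall j k, measurable (B j k)) /\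
    A = \bigcap_(j in [set j | j != i]) box_event (X j) (B j)].

Lemma measurable_box_event k (z : T -> 'cV[R]_k) B : rvec_measurable z ->
  (forall j, measurable (B j)) -> measurable (box_event z B).
Proof.
move=> mz mB; rewrite (_ : box_event _ _ = \bigcap_(j in setT)
    ((fun w => z w j 0) @^-1` B j)); last first.
  by apply/seteqP; split=> w /= h j; [move=> _|]; exact: h.
apply: fin_bigcap_measurable => [|j _]; first exact: finite_finset.
by have := mz j measurableT _ (mB j); rewrite setTI.
Qed.

Lemma measurable_other_events i : other_events i `<=` measurable.
Proof.
move=> _ [B [mB ->]]; apply: fin_bigcap_measurable => [|j _]; first exact: finite_finset.
exact: measurable_box_event.
Qed.

Lemma other_events_indep i A C : other_events i A -> (forall k, measurable (C k)) ->
  P (A `&` box_event (X i) C) = (P A * P (box_event (X i) C))%E.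
Proof.
move=> [B [mB ->]] mC.
have key D : (forall k, measurable (D k)) ->
  P (\bigcap_(j in [set j | j != i]) box_event (X j) (B j) `&` box_event (X i) D) =
  (P (box_event (X i) D) * \prod_(j < n | j != i) P (box_event (X j) (B j)))%E.
  move=> mD; pose B' j := if j == i then D else B j.
  have mB' j k : measurable (B' j k) by rewrite /B'; case: eqP.
  have -> : \bigcap_(j in [set j | j != i]) box_event (X j) (B j) `&`
      box_event (X i) D = \bigcap_(j in [set: 'I_n]) box_event (X j) (B' j).
    apply/seteqP; split=> [w [/= wB wD] j _ | w wB'].
      by rewrite /B'; case: eqP => [->//|/eqP ji]; exact: wB.
    split=> [j /= ji|]; first by have := wB' j I; rewrite /B' (negbTE ji).
    by have := wB' i I; rewrite /B' eqxx.
  rewrite indepX// (bigD1 i)//= {1}/B' eqxx; congr (_ * _)%E.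
  by apply: eq_bigr => j ji; rewrite /B' (negbTE ji).
have boxT : box_event (X i) (fun=> setT) = setT by apply/seteqP; split.
(* With the full box for sample [i], [key] identifies the product over [j != i] as the probability
   of the event itself. *)
have := key (fun=> setT) (fun=> measurableT).
rewrite boxT setIT probability_setT mul1e => ->.
by rewrite key// muleC.
Qed.

Lemma other_events_setI i : setI_closed (other_events i).
Proof.
move=> _ _ [B [mB ->]] [C [mC ->]].
exists (fun j k => B j k `&` C j k); split=> [j k|]; first exact: measurableI.
rewrite -bigcapI; apply: eq_bigcapr => j _.
by apply/seteqP; split=> [w [h1 h2] k|w h]; [split|split=> k; case: (h k)].
Qed.

Lemma other_eventsT i : other_events i setT.
Proof.
exists (fun _ _ => setT); split=> //.
by apply/seteqP; split.
Qed.

(** For a fixed box of sample [i], both sides are finite measures in [A] that agree on the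
    generating pi-system. *)
Lemma sigma_other_events_indep i A C : <<s other_events i>> A ->
  (forall k, measurable (C k)) ->
  P (A `&` box_event (X i) C) = (P A * P (box_event (X i) C))%E.
Proof.
move=> sA mC; have mE := measurable_box_event (mX i) mC.
have PE0 : 0 <= fine (P (box_event (X i) C)) by rewrite fine_ge0.
pose m1 := measure_function_mrestr__canonical__measure_function_Measure P mE.
pose m2 := measure_function_mscale__canonical__measure_function_Measure
  (NngNum PE0) P.
have m2E Y : m2 Y = (P Y * P (box_event (X i) C))%E.
  by rewrite /m2 /= /mscale /= fineK ?fin_num_measure// muleC.
rewrite -m2E.
apply: (g_sigma_algebra_measure_unique (other_events i) _ (fun=> setT) _ _ m1 m2) => //.
- exact: measurable_other_events.
- by move=> _; exact: other_eventsT.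
- by rewrite bigcup_const.
- exact: other_events_setI.
- by move=> B oB; rewrite m2E; exact: other_events_indep.
- by move=> _; rewrite /m1 /= /mrestr setTI ltey_eq fin_num_measure.
Qed.

Context (x : T -> 'cV[R]_m).
Hypothesis mx : rvec_measurable x.
Hypothesis lawX : forall i, same_law P (X i) x.
Hypothesis sq_int : forall a b, P.-integrable setT (fun w => (x w a 0 * x w b 0)%:E).

Lemma other_measurable_coord i j k : j != i ->
  measurable_fun (setT : set (g_sigma_algebraType (other_events i)))
    (fun w => X j w k 0).
Proof.
move=> ji _ A mA; rewrite setTI; apply: sub_sigma_algebra.
exists (fun j' k' => if (j' == j) && (k' == k) then A else setT).
split=> [j' k'|]; first by case: ifP.
apply/seteqP; split=> [w /= wA j' _ k'|w /= /(_ j ji k)].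
  by case: ifPn => // /andP[/eqP-> /eqP->].
by rewrite !eqxx.
Qed.

Lemma integral_indep_coord i (h : T -> R) K a b :
  measurable_fun (setT : set (g_sigma_algebraType (other_events i))) h ->
  (forall w, `|h w| <= K) ->
  P.-integrable setT (fun w => (h w * (X i w a 0 * X i w b 0))%:E) /\
  \int[P]_w (h w * (X i w a 0 * X i w b 0)) =
    \int[P]_w h w * \int[P]_w (x w a 0 * x w b 0).
Proof.
move=> smh hK.
have mh : measurable_fun (setT : set T) h.
  move=> _ A mA; have := smh measurableT A mA.
  apply: smallest_sub; first exact: sigma_algebra_measurable.
  exact: measurable_other_events.
apply: integral_indep_mul => //; try exact: mX; try exact: mx.
- move=> A B C mA mB mC.
  (* Constraining coordinates [a] and [b] by an intersection also covers the case [a = b]. *)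
  pose D k := (if k == a then A else setT) `&` (if k == b then B else setT).
  have mD k : measurable (D k) by apply: measurableI; case: ifP.
  have E (z : T -> 'cV[R]_m) : (fun w => z w a 0) @^-1` A `&`
      (fun w => z w b 0) @^-1` B = box_event z D.
    apply/seteqP; split=> [w [/= wA wB] k|w wD].
      by split; case: eqP => // ->.
    by split; [have [] := wD a|have [] := wD b]; rewrite eqxx.
  rewrite !E -(lawX i mD); apply: sigma_other_events_indep => //.
  by have := smh measurableT C mC; rewrite setTI.
- apply: measurable_bounded_integrable => //; first by rewrite ltey_eq fin_num_measure.
  exists K; split; first exact: num_real.
  by move=> y Ky w _ /=; rewrite (le_trans (hK w))// ltW.
- exact: sq_int.
Qed.

End sample.

(** * The finite-sample inequality *)

Section integrals.
Context {R : realType} {d : measure_display} {T : measurableType d} (P : probability T R).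

Definition rintegrable (f : T -> R) := P.-integrable setT (EFin \o f).

Lemma rintegrable_bounded (f : T -> R) K : measurable_fun setT f ->
  (forall w, `|f w| <= K) -> rintegrable f.
Proof.
move=> mf fK; apply: measurable_bounded_integrable => //.
  by rewrite ltey_eq fin_num_measure.
exists K; split; first exact: num_real.
by move=> y Ky w _ /=; rewrite (le_trans (fK w))// ltW.
Qed.

Lemma rintegrable_cst a : rintegrable (fun=> a).
Proof. exact: (@rintegrable_bounded _ `|a|). Qed.

Lemma rintegrableD f g : rintegrable f -> rintegrable g ->
  rintegrable (fun w => f w + g w).
Proof. exact: integrableD. Qed.

Lemma rintegrableZ a f : rintegrable f -> rintegrable (fun w => a * f w).
Proof. exact: integrableZl. Qed.

Lemma rintegrable_sum (I : finType) (f : I -> T -> R) :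
  (forall i, rintegrable (f i)) -> rintegrable (fun w => \sum_i f i w).
Proof.
move=> fi; rewrite /rintegrable (_ : _ \o _ = (fun w => \sum_i (f i w)%:E)%E).
  by apply: integrable_sum => // i _; exact: fi.
by apply/funext => w /=; rewrite sumEFin.
Qed.

Lemma Rintegral_sum (I : finType) (f : I -> T -> R) :
  (forall i, rintegrable (f i)) ->
  \int[P]_w (\sum_i f i w) = \sum_i \int[P]_w f i w.
Proof.
move=> fi; rewrite /Rintegral.
under eq_integral do rewrite -sumEFin.
rewrite integral_sum// sum_fine// => i _.
exact: integrable_fin_num (fi i).
Qed.

Lemma RintegralT_cst a : \int[P]_w a = a.
Proof. by rewrite Rintegral_cst// [X in fine X]probability_setT mulr1. Qed.

Lemma E_mxE m (A : T -> 'M[R]_m) i j : E_mx P A i j = \int[P]_w A w i j.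
Proof. by rewrite mxE unlock. Qed.

Section trace.
Context {m : nat} (A : T -> 'M[R]_m).
Hypothesis Aint : forall i j, rintegrable (fun w => A w i j).

Lemma rintegrable_trace (N : 'M[R]_m) : rintegrable (fun w => \tr (A w *m N)).
Proof.
apply: rintegrable_sum => i; under [X in rintegrable X]eq_fun do rewrite mxE.
apply: rintegrable_sum => j; under [X in rintegrable X]eq_fun do rewrite mulrC.
exact: rintegrableZ.
Qed.

Lemma trace_E_mx (N : 'M[R]_m) : \tr (E_mx P A *m N) = \int[P]_w \tr (A w *m N).
Proof.
rewrite /mxtrace Rintegral_sum; last first.
  move=> i; under [X in rintegrable X]eq_fun do rewrite mxE.
  apply: rintegrable_sum => j; under [X in rintegrable X]eq_fun do rewrite mulrC.
  exact: rintegrableZ.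
apply: eq_bigr => i _; rewrite mxE.
under eq_Rintegral do rewrite mxE.
rewrite Rintegral_sum; last first.
  move=> j; under [X in rintegrable X]eq_fun do rewrite mulrC.
  exact: rintegrableZ.
by apply: eq_bigr => j _; rewrite E_mxE RintegralZr//; exact: Aint.
Qed.

End trace.
End integrals.

Section quadratic_trace.
Context {R : realType} {m : nat}.

Lemma trace_outer (M : 'M[R]_m) v : \tr (M *m (v *m v^T)) = dot v (M *m v).
Proof. by rewrite mulmxA mxtrace_mulC /mxtrace big_ord1. Qed.

Lemma outer_mxE (v : 'cV[R]_m) i j : (v *m v^T) i j = v i 0 * v j 0.
Proof. by rewrite mxE big_ord1 [v^T _ _]mxE. Qed.

End quadratic_trace.

(** * Resolvents of the sample covariance with samples left out *)

Section resolvents.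
Context {R : realType} {n m : nat}.

(** [Q] selects the samples that are kept; the normalization stays [1 / n] even when some are
    dropped, so that restoring a sample is a rank-one update. *)
Definition partial_resolvent {T : Type} (X : 'I_n -> T -> 'cV[R]_m)
    (Q : pred 'I_n) (mu : R) (w : T) : 'M[R]_m :=
  invmx (n%:R^-1 *: \sum_(j | Q j) (X j w *m (X j w)^T) + mu%:M).

Lemma coercive_sample (x : 'I_n -> 'cV[R]_m) (Q : pred 'I_n) mu :
  coercive mu (n%:R^-1 *: \sum_(j | Q j) (x j *m (x j)^T) + mu%:M).
Proof.
rewrite -[X in coercive X]add0r; apply: coerciveDscalar.
have [ST S0] : coercive 0 (\sum_(j | Q j) (x j *m (x j)^T)).
  apply: (big_ind (coercive 0)) => [|A B [AT A0] [BT B0]|j _].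
  - split=> [|v]; first by rewrite trmx0.
    by rewrite mul0r mul0mx /dot mulmx0 mxE.
  - split=> [|v]; first by rewrite linearD/= AT BT.
    by have := A0 v; have := B0 v; rewrite mulmxDl dotDr; lra.
  - split=> [|v]; first by rewrite trmx_mul trmxK.
    by rewrite mul0r mul_outer dotZr dotC -expr2 sqr_ge0.
split=> [|v]; first by rewrite linearZ/= ST.
by rewrite mul0r -scalemxAl dotZr mulr_ge0// -[X in X <= _](mul0r (dot v v)).
Qed.

Lemma measurable_resolvent d (T : measurableType d) (X : 'I_n -> T -> 'cV[R]_m)
    (Q : pred 'I_n) (mu : R) : 0 < mu ->
  (forall j k, Q j -> measurable_fun setT (fun w => X j w k 0)) ->
  forall a b, measurable_fun setT (fun w => partial_resolvent X Q mu w a b).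
Proof.
move=> mu0 mX; apply: measurable_invmx => [w|a b].
  exact: coercive_unit mu0 (coercive_sample _ _ _).
under eq_fun do rewrite !mxE summxE.
apply: measurable_funD => //; apply: measurable_funM => //.
rewrite (_ : (fun w => _) = (fun w =>
    \sum_j (if Q j then (X j w *m (X j w)^T) a b else 0))); last first.
  by apply/funext => w; rewrite big_mkcond.
apply: measurable_sum => j; have [Qj|_] := boolP (Q j); last exact: measurable_cst.
under eq_fun do rewrite outer_mxE.
by apply: measurable_funM; exact: mX.
Qed.

Lemma resolvent_le (T : Type) (X : 'I_n -> T -> 'cV[R]_m)
    (Q : pred 'I_n) (mu : R) w a b : 0 < mu ->
  `|partial_resolvent X Q mu w a b| <= mu^-1.
Proof.
by move=> mu0; apply: invmx_coord_le => //; exact: coercive_sample.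
Qed.

End resolvents.

Section finite_sample.
Context {R : realType} {d : measure_display} {T : measurableType d} (P : probability T R).
Context {n m : nat} (x : T -> 'cV[R]_m) (X : 'I_n -> T -> 'cV[R]_m).
Hypothesis mX : forall i, rvec_measurable (X i).
Hypothesis mx : rvec_measurable x.
Hypothesis indepX : indep_family P X.
Hypothesis lawX : forall i, same_law P (X i) x.
Hypothesis sq_int : forall a b, rintegrable P (fun w => x w a 0 * x w b 0).
Variables (S : 'M[R]_m) (smin smax : R).
Hypothesis SE : forall a b, S a b = \int[P]_w (x w a 0 * x w b 0).
Hypotheses (smin0 : 0 < smin) (smax0 : 0 <= smax).
Hypotheses (Smin : coercive smin S) (Smax : coercive (- smax) (- S)).

(** The trace of [N S] is the expectation of [x . N x], which avoids a square root of [S]. *)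
Lemma trace_cov_ge0 (N : 'M[R]_m) : (forall v, 0 <= dot v (N *m v)) -> 0 <= \tr (N *m S).
Proof.
move=> N0; suff -> : \tr (N *m S) = \int[P]_w dot (x w) (N *m x w).
  by apply: Rintegral_ge0 => w _; exact: N0.
under eq_Rintegral do rewrite quad_sum.
rewrite Rintegral_sum; last first.
  by move=> a; apply: rintegrable_sum => b; exact: rintegrableZ.
apply: eq_bigr => a _; rewrite Rintegral_sum; last by move=> b; exact: rintegrableZ.
rewrite mxE; apply: eq_bigr => b _; rewrite RintegralZl//; last exact: sq_int.
by rewrite SE; congr (_ * _); apply: eq_Rintegral => w _; rewrite mulrC.
Qed.

Lemma trace_cov_le (M N : 'M[R]_m) : (forall v, dot v (M *m v) <= dot v (N *m v)) ->
  \tr (M *m S) <= \tr (N *m S).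
Proof.
move=> MN; rewrite -subr_ge0 -linearB/= -mulmxBl trace_cov_ge0// => v.
by rewrite mulmxBl !dotl subr_ge0.
Qed.

Lemma trace_le (M N : 'M[R]_m) : (forall v, dot v (M *m v) <= dot v (N *m v)) ->
  \tr M <= \tr N.
Proof.
move=> MN; rewrite -subr_ge0 -linearB/= trace_ge0// => v.
by rewrite mulmxBl !dotl subr_ge0.
Qed.

Let G mu := partial_resolvent X xpredT mu.
Let H i mu := partial_resolvent X (predC1 i) mu.

Lemma rintegrable_resolvent Q mu a b : 0 < mu ->
  rintegrable P (fun w => partial_resolvent X Q mu w a b).
Proof.
move=> mu0; apply: (@rintegrable_bounded _ _ _ _ _ mu^-1).
  by apply: measurable_resolvent => // j k _; exact: mX.
by move=> w; exact: resolvent_le.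
Qed.

(** Written as expected traces against [v v^T], both sides compare pointwise by [dot_invmx_anti].
    This trades the vanishing [lam] for a fixed [mu]. *)
Lemma E_resolvent_anti (mu lam : R) v : 0 < lam -> lam <= mu ->
  dot v (E_mx P (G mu) *m v) <= dot v (E_mx P (G lam) *m v).
Proof.
move=> lam0 lemu; have mu0 := lt_le_trans lam0 lemu.
have iG := rintegrable_resolvent xpredT.
rewrite -!trace_outer !trace_E_mx; try by move=> *; exact: iG.
apply: le_Rintegral => //; try by apply: rintegrable_trace => *; exact: iG.
move=> w _; rewrite !trace_outer /G /partial_resolvent.
have -> : mu%:M = lam%:M + (mu - lam)%:M :> 'M[R]_m by rewrite -raddfD/= addrC subrK.
rewrite addrA; apply: dot_invmx_anti lam0 _ (coercive_sample _ _ _).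
by rewrite subr_ge0.
Qed.

Section fixed_regularization.
Variable mu : R.
Hypothesis mu0 : 0 < mu.

Let q i w := n%:R^-1 * dot (X i w) (H i mu w *m X i w).

Lemma resolvent_rank_one i w : G mu w = invmx ((n%:R^-1 *: \sum_(j | j != i)
  (X j w *m (X j w)^T) + mu%:M) + n%:R^-1 *: (X i w *m (X i w)^T)).
Proof.
by rewrite /G /partial_resolvent (bigD1 i)//= scalerDr -addrA addrC.
Qed.

Lemma q_ge0 i w : 0 <= q i w.
Proof. exact: rank_one_ge0 mu0 _ (coercive_sample _ _ _). Qed.

(** With [u = H_i x_i], the two traces differ by [n^-1 (u . S u) / (1 + q_i)]. Since
    [u . S u <= smax |u|^2] and [n^-1 mu |u|^2 <= q_i], this is at most
    [(smax / mu) q_i / (1 + q_i)]. *)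
Lemma trace_leave_one_out i w :
  \tr (H i mu w *m S) <= \tr (G mu w *m S) + smax / mu.
Proof.
have n0 : 0 <= n%:R^-1 :> R by [].
have cM := coercive_sample (X^~ w) (predC1 i) mu.
rewrite {1}/H /partial_resolvent (invmx_rank_one (X i w) mu0 n0 cM).
rewrite -resolvent_rank_one mulmxDl linearD/= lerD2l -scalemxAl linearZ/=.
rewrite mxtrace_mulC trace_outer.
set u := _ *m X i w; rewrite -/(q i w).
have q0 := q_ge0 i w; have q1 : 0 < 1 + q i w by lra.
have h1 : dot u (S *m u) <= smax * dot u u.
  by have := Smax.2 u; rewrite mulNmx dotNr; lra.
have h2 : mu * dot u u <= dot (X i w) u := dot_invmx_ge (X i w) mu0 cM.
have h3 : n%:R^-1 * (mu * dot u u) <= q i w by rewrite ler_wpM2l.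
rewrite mulrAC ler_pdivrMr//.
apply: (@le_trans _ _ (smax / mu * (n%:R^-1 * (mu * dot u u)))).
  rewrite mulrCA [smax / mu * _]mulrA divfK ?gt_eqF//.
  by rewrite ler_wpM2l.
rewrite ler_wpM2l ?divr_ge0 ?(ltW mu0)//.
by apply: le_trans h3 _; rewrite lerDr.
Qed.

(** [H_i] is built from the other samples, hence independent of [X i], and its entries are bounded
    by [mu^-1]. *)
Lemma integral_resolvent_coord i a b :
  rintegrable P (fun w => H i mu w a b * (X i w a 0 * X i w b 0)) /\
  \int[P]_w (H i mu w a b * (X i w a 0 * X i w b 0)) =
    E_mx P (H i mu) a b * S a b.
Proof.
rewrite E_mxE SE; apply: (integral_indep_coord mX indepX mx lawX sq_int).
  apply: (@measurable_resolvent _ _ _ _ (g_sigma_algebraType (other_events X i))) => //.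
  by move=> j k ji; exact: other_measurable_coord.
by move=> w; exact: resolvent_le.
Qed.

Lemma rintegrable_q i : rintegrable P (q i).
Proof.
apply: rintegrableZ; under [X in rintegrable _ X]eq_fun do rewrite quad_sum.
apply: rintegrable_sum => a; apply: rintegrable_sum => b.
exact: (integral_resolvent_coord i a b).1.
Qed.

Lemma Rintegral_q i : \int[P]_w q i w = n%:R^-1 * \tr (E_mx P (H i mu) *m S).
Proof.
have iHX a b := (integral_resolvent_coord i a b).1.
rewrite RintegralZl//; last first.
  under [X in integrable _ _ X]eq_fun do rewrite quad_sum.
  by apply: rintegrable_sum => a; apply: rintegrable_sum => b; exact: iHX.
congr (_ * _); under eq_Rintegral do rewrite quad_sum.
rewrite Rintegral_sum; last by move=> a; apply: rintegrable_sum => b; exact: iHX.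
apply: eq_bigr => a _; rewrite Rintegral_sum; last by move=> b; exact: iHX.
rewrite mxE; apply: eq_bigr => b _.
rewrite (integral_resolvent_coord i a b).2; congr (_ * _).
(* Symmetry of [S] turns the sum of entrywise products into a trace. *)
by rewrite -[in RHS]Smin.1 mxE.
Qed.

(** The trace of [A^-1 A] is expanded over the samples; [dot_rank_one] expresses each term
    [n^-1 x_i . G x_i] through [q_i]. *)
Lemma resolvent_trace_identity w :
  \sum_i (1 - (1 + q i w)^-1) + mu * \tr (G mu w) = m%:R.
Proof.
have n0 : 0 <= n%:R^-1 :> R by [].
have cA := coercive_sample (X^~ w) xpredT mu.
rewrite -[RHS](@mxtrace1 R m) -[in RHS](mulVmx (coercive_unit mu0 cA)).
rewrite mulmxDr mxtraceD mul_mx_scalar mxtraceZ; congr (_ + _).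
rewrite -scalemxAr mxtraceZ mulmx_sumr raddf_sum/= mulr_sumr.
apply: eq_bigr => i _.
have cM := coercive_sample (X^~ w) (predC1 i) mu.
rewrite trace_outer -[LHS](dot_rank_one (X i w) mu0 n0 cM).
by rewrite -resolvent_rank_one.
Qed.

(* [1 - (1 + q)^-1] is concave in [q >= 0], so it lies below its tangent line
   at [tau]; taking expectations of the tangent lines gives the bound. *)
Lemma resolvent_trace_bound (tau : R) : 0 <= tau ->
  (forall i, n%:R^-1 * \tr (E_mx P (H i mu) *m S) <= tau) ->
  m%:R - mu * \tr (E_mx P (G mu)) <= n%:R * (tau / (1 + tau)).
Proof.
move=> tau0 Htau; have iG a b := rintegrable_resolvent xpredT a b mu0.
have t1 : 0 < 1 + tau by lra.
(* The slope of the tangent at [tau]. It is nonnegative, so an upper bound on the mean of [q_i]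
   suffices below. *)
pose s := (1 + tau)^-1 ^+ 2.
have s0 : 0 <= s by rewrite sqr_ge0.
pose L i w := (tau / (1 + tau) - s * tau) + s * q i w.
have tangent i w : 1 - (1 + q i w)^-1 <= L i w.
  have q0 := q_ge0 i w; rewrite /L /s; set r := q i w in q0 *.
  rewrite -subr_ge0 (_ : _ - _ = (r - tau) ^+ 2 / ((1 + r) * (1 + tau) ^+ 2)).
    by rewrite divr_ge0 ?sqr_ge0// mulr_ge0 ?sqr_ge0//; lra.
  by field; apply/andP; split; lra.
have iL i : rintegrable P (L i).
  by apply: rintegrableD; [exact: rintegrable_cst|exact/rintegrableZ/rintegrable_q].
have EL i : \int[P]_w L i w <= tau / (1 + tau).
  rewrite RintegralD//; [|exact: rintegrable_cst|exact/rintegrableZ/rintegrable_q].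
  rewrite RintegralT_cst RintegralZl//; last exact: rintegrable_q.
  rewrite Rintegral_q; have := ler_wpM2l s0 (Htau i); lra.
have itr : rintegrable P (fun w => mu * \tr (G mu w)).
  apply: rintegrableZ.
  under [X in rintegrable _ X]eq_fun do rewrite -[G mu _]mulmx1.
  exact: rintegrable_trace.
have : \int[P]_w m%:R <= \int[P]_w (\sum_i L i w + mu * \tr (G mu w)).
  apply: le_Rintegral => //; first exact: rintegrable_cst.
    by apply: rintegrableD => //; exact: rintegrable_sum.
  move=> w _; rewrite -[leLHS](resolvent_trace_identity w) lerD2r.
  by apply: ler_sum => i _; exact: tangent.
rewrite RintegralT_cst RintegralD//; last exact: rintegrable_sum.
rewrite Rintegral_sum// RintegralZl//; last first.
  under [X in integrable _ _ X]eq_fun do rewrite -[G mu _]mulmx1.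
  exact: rintegrable_trace.
rewrite -[E_mx P (G mu)]mulmx1 trace_E_mx; last by move=> *; exact: iG.
under [in X in _ -> _ - mu * X <= _]eq_Rintegral do rewrite mulmx1.
move=> h; rewrite lerBlDr (le_trans h)// lerD2r.
rewrite mulr_natl -[X in _ *+ X]card_ord -sumr_const.
by apply: ler_sum => i _; exact: EL.
Qed.
End fixed_regularization.

(** Splitting [E[G_lam] = D + (S + lam)^-1] and bounding the quadratic form of [D] by [c] gives [tr
    (E[G_mu] S) <= m (1 + c smax)]; leaving one sample out adds [smax / mu], whence [tau]. The same
    splitting gives [tr E[G_mu] <= m (smin^-1 + c)]. *)
Lemma finite_sample_bound (lam mu c : R) :
  let D := E_mx P (G lam) - invmx (S + lam%:M) in
  0 < lam -> lam <= mu -> (0 < n)%N -> 0 <= c -> opnorm D <= c ->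
  let tau := (m%:R * (1 + c * smax) + smax / mu) / n%:R in
  m%:R * (1 - mu * (smin^-1 + c)) * (1 + tau) <= n%:R * tau.
Proof.
move=> D lam0 lemu n0 c0 Dc /=; set tau := (_ / n%:R).
have mu0 := lt_le_trans lam0 lemu.
have nR : 0 < n%:R :> R by rewrite ltr0n.
have tau0 : 0 <= tau.
  rewrite /tau divr_ge0// addr_ge0 ?divr_ge0 ?(ltW mu0)//.
  by rewrite mulr_ge0// addr_ge0// mulr_ge0.
have cB := coerciveDscalar lam Smin.
have b0 : 0 < smin + lam by rewrite addr_gt0.
have Bu := coercive_unit b0 cB.
have scalarE a v : dot v (a%:M *m v) = a * dot v v :> R.
  by rewrite mul_scalar_mx dotZr.
have DleC v : dot v (D *m v) <= dot v (c%:M *m v).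
  by rewrite scalarE (le_trans (quad_le_opnorm _ _))// ler_wpM2r ?dot_ge0.
have trS : \tr S <= smax * m%:R.
  rewrite mulr_natr -mxtrace_scalar; apply: trace_le => v.
  by have := Smax.2 v; rewrite scalarE mulNmx dotNr; lra.
have DE : E_mx P (G lam) = D + invmx (S + lam%:M) by rewrite subrK.
have trB : \tr (invmx (S + lam%:M)) <= m%:R / smin.
  rewrite mulr_natl -mxtrace_scalar; apply: trace_le => v.
  rewrite scalarE (le_trans (dot_invmx_le v b0 cB))// ler_wpM2r ?dot_ge0//.
  by rewrite lef_pV2 ?posrE// lerDl ltW.
have trB0 : 0 <= \tr (invmx (S + lam%:M)).
  by apply: trace_ge0 => v; exact: dot_invmx_ge0 b0 cB.
have trBS : \tr (invmx (S + lam%:M) *m S) <= m%:R.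
  have -> : invmx (S + lam%:M) *m S = 1%:M - lam *: invmx (S + lam%:M).
    by rewrite -{2}[S](addrK lam%:M) mulmxBr mulVmx// mul_mx_scalar.
  by rewrite linearB linearZ/= mxtrace1 gerBl mulr_ge0// ltW.
have trES : \tr (E_mx P (G mu) *m S) <= m%:R * (1 + c * smax).
  apply: le_trans (trace_cov_le (fun v => E_resolvent_anti v lam0 lemu)) _.
  rewrite DE mulmxDl linearD/= mulrDr mulr1 addrC lerD//.
  apply: le_trans (trace_cov_le DleC) _.
  by rewrite mul_scalar_mx linearZ/= mulrCA ler_wpM2l// mulrC.
have trE : \tr (E_mx P (G mu)) <= m%:R * (smin^-1 + c).
  apply: le_trans (trace_le (fun v => E_resolvent_anti v lam0 lemu)) _.
  rewrite DE linearD/= mulrDr addrC lerD//.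
  by apply: le_trans (trace_le DleC) _; rewrite mxtrace_scalar mulr_natl.
have Htau i : n%:R^-1 * \tr (E_mx P (H i mu) *m S) <= tau.
  rewrite /tau mulrC ler_pM2r ?invr_gt0//.
  apply: (@le_trans _ _ (\tr (E_mx P (G mu) *m S) + smax / mu)); last by rewrite lerD2r.
  have iG Q a b := rintegrable_resolvent Q a b mu0.
  rewrite !trace_E_mx; try by move=> *; exact: iG.
  rewrite -[X in _ + X](RintegralT_cst P) -RintegralD//; last 2 first.
  - by apply: rintegrable_trace => *; exact: iG.
  - exact: rintegrable_cst.
  apply: le_Rintegral => //.
  - by apply: rintegrable_trace => *; exact: iG.
  - apply: rintegrableD; last exact: rintegrable_cst.
    by apply: rintegrable_trace => *; exact: iG.
  - by move=> w _; exact: trace_leave_one_out.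
have := resolvent_trace_bound mu0 tau0 Htau.
rewrite mulrA ler_pdivlMr; last lra.
apply: le_trans; rewrite ler_wpM2r; [by []|lra|].
rewrite mulrBr mulr1 lerB// mulrCA.
by rewrite ler_pM2l.
Qed.
End finite_sample.

(** * Passage to the limit *)

Section limit_inferior.
Context {R : realType}.

(** Eventual bounds pass to the tail infima. Asking only for [c < l] leaves the strict gap that the
    final contradiction uses. *)
Lemma limn_einf_ge (u : nat -> R) (l : R) :
  (forall c, c < l -> \forall n \near \oo, c <= u n) ->
  (l%:E <= limn_einf (fun n => (u n)%:E))%E.
Proof.
move=> ul; apply/lee_subgt0Pr => e e0; rewrite -EFinB limn_einf_lim.
apply: lime_ge; first exact: is_cvg_einfs.
have : l - e < l by rewrite gtrBl.
move=> /ul[N _ HN]; exists N => // n /= Nn.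
apply: le_ereal_inf_tmp => _ [k /= nk <-]; rewrite lee_fin.
by apply: HN => /=; exact: leq_trans nk.
Qed.

Lemma cvg_natV : (fun n : nat => n%:R^-1 : R) @ \oo --> (0 : R).
Proof. by rewrite -cvg_shiftS; exact: cvg_harmonic. Qed.

End limit_inferior.

(** * Second moments and spectrum of the covariance matrix *)

Section covariance_matrix.
Context {R : realType} {d : measure_display} {T : measurableType d} (P : probability T R).
Context {m : nat} (x : T -> 'cV[R]_m).
Hypothesis mx : rvec_measurable x.

(** Basis vectors are unit vectors, so each coordinate has a finite fourth moment, and
    [|s t| <= 1 + s^4 + t^4]. *)
Lemma moment4_rintegrable a b : (moment4 P x < +oo)%E ->
  rintegrable P (fun w => x w a 0 * x w b 0).
Proof.
move=> M4; have i4 k : rintegrable P (fun w => x w k 0 ^+ 4).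
  apply/integrableP; split.
    by apply/measurable_EFinP; apply: measurable_funX; exact: mx.
  apply: le_lt_trans M4; apply: ereal_sup_ubound.
  exists (delta_mx k 0) => /=.
    have := dot_delta (1%:M : 'M[R]_m) k; rewrite mul1mx vnormE => ->.
    by rewrite mxE eqxx sqrtr1.
  rewrite unlock; apply: eq_integral => w _ /=.
  by rewrite trmx_delta -rowE mxE ger0_norm// exprn_even_ge0.
have i' : rintegrable P (fun w => 1 + (x w a 0 ^+ 4 + x w b 0 ^+ 4)).
  by apply: rintegrableD; [exact: rintegrable_cst|exact: rintegrableD].
apply: le_integrable i' => //.
  by apply/measurable_EFinP; apply: measurable_funM; exact: mx.
move=> w _ /=; rewrite lee_fin.
set s := x w a 0; set t := x w b 0.
rewrite [leRHS]ger0_norm; last first.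
  by rewrite addr_ge0// addr_ge0// exprn_even_ge0.
have s4 : s ^+ 4 = (s ^+ 2) ^+ 2 by rewrite -exprM.
have t4 : t ^+ 4 = (t ^+ 2) ^+ 2 by rewrite -exprM.
(* From [(s^2 - 1/2)^2 >= 0] one gets [s^2 <= s^4 + 1/4], and likewise for [t]. *)
rewrite s4 t4 ler_norml; apply/andP; split.
  have := sqr_ge0 (s + t); have := sqr_ge0 (s ^+ 2 - 2^-1).
  have := sqr_ge0 (t ^+ 2 - 2^-1); nra.
have := sqr_ge0 (s - t); have := sqr_ge0 (s ^+ 2 - 2^-1).
have := sqr_ge0 (t ^+ 2 - 2^-1); nra.
Qed.

Hypothesis x0 : forall j, ('E_P[fun w => (x w j 0)%R] = 0)%E.

Lemma cov_mxE a b : cov_mx P x a b = \int[P]_w (x w a 0 * x w b 0).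
Proof.
rewrite mxE unlock !x0 /= unlock; congr fine.
apply: eq_integral => w _; congr EFin.
by rewrite -[LHS]/((x w a 0 - 0) * (x w b 0 - 0)) !subr0.
Qed.

Lemma trmx_cov_mx : (cov_mx P x)^T = cov_mx P x.
Proof.
apply/matrixP => a b; rewrite mxE !cov_mxE.
by apply: eq_Rintegral => w _; rewrite mulrC.
Qed.

End covariance_matrix.

Section spectrum.
Context {R : realType} {m : nat} (S : 'M[R]_m) (s : seq R) (smin smax : R).
Hypothesis ST : S^T = S.
Hypothesis charS : char_poly S = \prod_(a <- s) ('X - a%:P).
Hypothesis s_itv : all (fun a => smin <= a <= smax) s.

Lemma coercive_spectrum_ge : coercive smin S.
Proof.
apply: coercive_char_poly => // a; rewrite charS root_prod_XsubC.
by move=> /(allP s_itv)/andP[].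
Qed.

Lemma coercive_spectrum_le : coercive (- smax) (- S).
Proof.
apply: coercive_char_poly => [|a]; first by rewrite linearN/= ST.
rewrite -eigenvalue_root_char => /eigenvalueP[v vS v0].
have : root (char_poly S) (- a).
  rewrite -eigenvalue_root_char; apply/eigenvalueP; exists v => //.
  by rewrite scaleNr -vS mulmxN opprK.
rewrite charS root_prod_XsubC => /(allP s_itv)/andP[_].
by rewrite lerNl.
Qed.

(** In positive dimension there is at least one eigenvalue, and it lies between the two bounds. *)
Lemma spectrum_bounds_le : (0 < m)%N -> smin <= smax.
Proof.
have := size_char_poly S; rewrite charS size_prod_XsubC => -[<-].
case: s s_itv => //= a l /andP[/andP[h1 h2] _] _; exact: le_trans h2.
Qed.

End spectrum.

(** * Contradiction in the limit for a small bias *)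

Section bias_limit.
Context {R : realType}.

(* The finite-sample inequality divided by [n] forces
   [y (1 - mu K) (1 + tau) <= tau] in the limit, where [tau = y (1 + c smax)];
   for small [mu] this contradicts [c smax < y]. *)
Lemma finite_sample_bound_fails (dim : nat -> nat) (y c smax K : R) :
  (fun n => (dim n)%:R / n%:R : R) @ \oo --> y ->
  0 <= c -> 0 <= smax -> c * smax < y -> 0 <= K ->
  exists2 mu, 0 < mu & \forall n \near \oo,
    let tau := ((dim n)%:R * (1 + c * smax) + smax / mu) / n%:R in
    n%:R * tau < (dim n)%:R * (1 - mu * K) * (1 + tau).
Proof.
move=> dimy c0 smax0 cy K0.
pose t := y * (1 + c * smax); pose g := y * (1 + t) - t.
have cs0 : 0 <= c * smax by rewrite mulr_ge0.
have y0 : 0 < y by apply: le_lt_trans cy.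
have t0 : 0 < t by rewrite mulr_gt0// ltr_pwDl.
(* [g] is the limiting gap at [mu = 0]. Positivity uses [y (1 + c smax) >= y > c smax]. *)
have g0 : 0 < g.
  rewrite (_ : g = y * (t - c * smax)); last by rewrite /g /t; ring.
  rewrite mulr_gt0// subr_gt0 /t.
  nra.
pose q := y * K * (1 + t).
have q0 : 0 <= q by rewrite !mulr_ge0 ?(ltW y0)// addr_ge0// ltW.
(* At regularization [mu] the limiting gap is [g - q mu]; this choice gives [q mu < g] even when
   [q = 0]. *)
exists (g / (1 + q)); first by rewrite divr_gt0// ltr_pwDl.
set mu := g / (1 + q).
have muq : q * mu < g.
  rewrite /mu mulrA ltr_pdivrMr; last by rewrite ltr_pwDl.
  rewrite mulrC ltr_pM2l// ltrDr.
  by [].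
pose tau n : R := ((dim n)%:R / n%:R) * (1 + c * smax) + (smax / mu) * n%:R^-1.
have tau_cvg : tau n @[n --> \oo] --> t.
  rewrite -[t]addr0 -[X in _ + X](mulr0 (smax / mu)).
  apply: cvgD; apply: cvgM => //; try exact: cvg_cst.
  exact: cvg_natV.
have Fcvg : (dim n)%:R / n%:R * (1 - mu * K) * (1 + tau n) - tau n
    @[n --> \oo] --> y * (1 - mu * K) * (1 + t) - t.
  apply: cvgB => //; apply: cvgM; first by apply: cvgM => //; exact: cvg_cst.
  by apply: cvgD => //; exact: cvg_cst.
have F0 : 0 < y * (1 - mu * K) * (1 + t) - t.
  rewrite (_ : _ - t = g - q * mu); last by rewrite /g /q; ring.
  by rewrite subr_gt0.
near=> n.
have n0 : (0 < n)%N by near: n; exists 1%N.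
have nR : 0 < n%:R :> R by rewrite ltr0n.
have tauE : ((dim n)%:R * (1 + c * smax) + smax / mu) / n%:R = tau n.
  by rewrite /tau mulrDl mulrAC.
rewrite /= tauE -subr_gt0.
have : 0 < (dim n)%:R / n%:R * (1 - mu * K) * (1 + tau n) - tau n.
  by near: n; exact: cvgr_gt F0.
have eqF (e a b u v : R) : e != 0 -> e * (a / e * b * u - v) = a * b * u - e * v.
  by move=> e0; field.
by move=> /(mulr_gt0 nR); rewrite eqF// gt_eqF.
Unshelve. all: by end_near.
Qed.

End bias_limit.

Unset Implicit Arguments. Set Strict Implicit. Set Printing Implicit Defensive.

Theorem theorem2p5 (R : realType) (d0 : measure_display) (T : measurableType d0)
  (P : probability T R) (dim : nat -> nat) (y : R)
  (x : forall n : nat, T -> 'cV[R]_(dim n))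
  (X : forall n : nat, 'I_n -> T -> 'cV[R]_(dim n))
  (spec : nat -> seq R) (FS : R -> R) (smin smax : R) (lam : nat -> R) :
  (* asymptotic framework *)
  0 <= y < 1 ->
  (fun n => (dim n)%:R : R) @ \oo --> +oo ->
  (fun n => (dim n)%:R / n%:R : R) @ \oo --> y ->
  (* x_n is a random vector, X n 0 .. X n (n-1) are i.i.d. copies of x_n *)
  (forall n, rvec_measurable (x n)) ->
  (forall n (i : 'I_n), rvec_measurable (X n i)) ->
  (forall n (i : 'I_n), same_law P (X n i) (x n)) ->
  (forall n, indep_family P (X n)) ->
  (* E x = 0 *)
  (forall n (j : 'I_(dim n)), P.-integrable setT (fun w => (x n w j 0)%:E)) ->
  (forall n (j : 'I_(dim n)), ('E_P[fun w => (x n w j 0)%R] = 0)%E) ->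
  (* spec n is the list of eigenvalues (with multiplicity) of Sigma_n = Cov(x_n) *)
  (forall n, char_poly (cov_mx P (x n)) = \prod_(a <- spec n) ('X - a%:P)) ->
  (* (A1) *)
  {ae lebesgue_measure, forall u : R, 0 <= u ->
      (fun n => esd (spec n) (dim n) u) @ \oo --> FS u} ->
  (* (A2) *)
  (forall n, (moment4 P (x n) < +oo)%E) ->
  (fun n => nu P (x n)) @ \oo --> 0%E ->
  (* (A3) *)
  0 < smin ->
  (forall n, all (fun a => smin <= a <= smax) (spec n)) ->
  (* lambda_n > 0, lambda_n = o(1) *)
  (forall n, 0 < lam n) ->
  lam @ \oo --> 0 ->
  ((y * smin / smax ^+ 2)%:E <=
     limn_einf (fun n =>
       (opnorm (E_mx P (fun w => invmx (Shat (X n) w + (lam n)%:M))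
                - invmx (cov_mx P (x n) + (lam n)%:M)))%:E))%E.
Proof.
move=> /andP[y0 _] dim_oo dim_y mx mX lawX indepX _ x0 charS _ M4 _ smin0 s_itv
  lam0 lam_cvg.
apply: limn_einf_ge => c cl.
(* A negative [c] is below every operator norm; the finite-sample inequality takes [c >= 0]. *)
have [c_lt0|c0] := ltP c 0.
  by near=> n; rewrite (le_trans (ltW c_lt0))// opnorm_ge0.
have smin_max : smin <= smax.
  have : \forall n \near \oo, 0 < (dim n)%:R :> R by exact: cvgry_gt.
  move=> [N _ /(_ N (leqnn N))]; rewrite /= ltr0n.
  exact: spectrum_bounds_le (charS N) (s_itv N).
have smax0 : 0 < smax := lt_le_trans smin0 smin_max.
(* The contradiction needs only [c smax < y], which follows from [smin / smax <= 1]. *)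
have cy : c * smax < y.
  apply: (@lt_le_trans _ _ (y * smin / smax ^+ 2 * smax)); first by rewrite ltr_pM2r.
  rewrite (_ : _ * smax = y * (smin / smax)); last by field; rewrite gt_eqF.
  by rewrite ler_piMr// ler_pdivrMr// mul1r.
have K0 : 0 <= smin^-1 + c by rewrite addr_ge0// invr_ge0 ltW.
have [mu mu0 bound_fails] := finite_sample_bound_fails dim_y c0 (ltW smax0) cy K0.
near=> n; rewrite leNgt; apply/negP => opc.
have ST := trmx_cov_mx (x0 n).
have SE := cov_mxE (x0 n).
have sq_int a b := moment4_rintegrable (mx n) a b (M4 n).
have lam_le : lam n <= mu.
  by apply/ltW; near: n; exact: cvgr_lt lam_cvg _ mu0.
have n0 : (0 < n)%N by near: n; exists 1%N.
(* By conversion, the resolvent of [Shat] is [partial_resolvent] with all samples kept. *)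
have := finite_sample_bound (mX n) (mx n) (indepX n) (lawX n) sq_int SE smin0
  (ltW smax0) (coercive_spectrum_ge ST (charS n) (s_itv n))
  (coercive_spectrum_le ST (charS n) (s_itv n)) (lam0 n) lam_le n0 c0 (ltW opc).
rewrite /= leNgt => /negP; apply.
by near: n; exact: bound_fails.
Unshelve. all: by end_near.
Qed.
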